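(* Let $\mathbb{F}$ be a field of characteristic different from $2$ and $3$. The Albert algebra $A(\mathbb{F})$ is an axial $\mathbb{F}$-algebra of Jordan type $\frac12$ generated by the four primitive axes $$a=\tfrac12(1,1,0\mid 0,0,i_0),\quad b=\tfrac12(1,0,1\mid 0,i_1,0),\quad c=\tfrac12(0,1,1\mid i_2,0,0),\quad d=\tfrac19(1,4,4\mid 4i_4,2i_3,2i_6).$$
   Context: **Octonions.** $\mathbb{O}$ is the 8-dimensional unital $\mathbb{F}$-algebra with basis $1,i_0,\dots,i_6$ (subscripts modulo 7) such that $i_t^2=-1$ for all $t$ and, for every $t$, the elements $i=i_t$, $j=i_{t+1}$, $k=i_{t+3}$ multiply as in the quaternions: $ij=k=-ji$, $jk=i=-kj$, $ki=j=-ik$. Conjugation $x\mapsto\overline{x}$ is the linear map fixing $1$ and negating every $i_n$. **Albert algebra.** $A(\mathbb{F})$ is the 27-dimensional space of $3\times3$ Hermitian matrices ($x^T=\overline{x}$) over $\mathbb{O}$ with diagonal entries in $\mathbb{F}$, with product $X\circ Y=\frac12(XY+YX)$. Notation, for $d,e,f\in\mathbb{F}$ and $D,E,F\in\mathbb{O}$: $$(d,e,f\mid D,E,F)=\begin{pmatrix} d & F & \overline{E}\\ \overline{F} & e & D\\ E & \overline{D} & f\end{pmatrix}.$$ **Axial algebras of Jordan type.** Let $A$ be a commutative (not necessarily associative) $\mathbb{F}$-algebra. For $a\in A$ and $\lambda\in\mathbb{F}$ put $A_\lambda(a)=\{b\in A: ab=\lambda b\}$. An axis is an idempotent $a$ whose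 adjoint operator $b\mapsto ab$ is semisimple (diagonalizable); it is primitive if $A_1(a)$ is one-dimensional, spanned by $a$. $A$ is an axial algebra of Jordan type $\eta$ ($\eta\ne0,1$) generated by a given set of primitive axes if that set generates $A$ as an algebra and each member $a$ satisfies $A=A_1(a)\oplus A_0(a)\oplus A_\eta(a)$, $A_0(a)^2\subseteq A_0(a)$, and $A_\delta(a)A_\epsilon(a)\subseteq A_{\delta\epsilon}(a)$ for all $\delta,\epsilon\in\{+,-\}$, where $A_+(a)=A_1(a)\oplus A_0(a)$ and $A_-(a)=A_\eta(a)$. *)

(* Defs.v *)
From HB Require Import structures.
From mathcomp Require Import all_boot all_order all_algebra.
From mathcomp Require Import ring.

Set Implicit Arguments.
Unset Strict Implicit.
Unset Printing Implicit Defensive.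

Import GRing.Theory.
Local Open Scope ring_scope.

(* Algebras over a field that are neither assumed associative nor unital.     *)

HB.mixin Record Lmodule_isNonAssocAlgebra (F : fieldType) A
    of GRing.Lmodule F A := {
  namul : A -> A -> A;
  namulDl : left_distributive namul +%R;
  namulDr : right_distributive namul +%R;
  namulZl : forall (k : F) x y, namul (k *: x) y = k *: namul x y;
  namulZr : forall (k : F) x y, namul x (k *: y) = k *: namul x y
}.

#[short(type="naAlgType")]
HB.structure Definition NonAssocAlgebra (F : fieldType) :=
  { A of GRing.Lmodule F A & Lmodule_isNonAssocAlgebra F A }.

HB.mixin Record NonAssocAlgebra_isCommutative (F : fieldType) A
    of NonAssocAlgebra F A := {
  namulC : commutative (@namul F A)
}.

#[short(type="comNaAlgType")]
HB.structure Definition ComNonAssocAlgebra (F : fieldType) :=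
  { A of NonAssocAlgebra F A & NonAssocAlgebra_isCommutative F A }.

Notation "x ** y" := (namul x y)
  (at level 40, left associativity) : ring_scope.

Section JordanType.
Variables (F : fieldType) (A : comNaAlgType F).
Implicit Types (a b x y : A) (l eta : F) (S : A -> Prop).

Definition eigen a l b : Prop := a ** b = l *: b.

(* A is the sum of the eigenspaces of b |-> a ** b; such a sum is always      *)
(* direct.                                                                    *)
Definition semisimple a : Prop :=
  forall x, exists s : seq (F * A),
    (forall p, p \in s -> eigen a p.1 p.2) /\ x = \sum_(p <- s) p.2.

Definition axis a : Prop := a ** a = a /\ semisimple a.

Definition primitive_axis a : Prop :=
  [/\ axis a, a != 0 & forall x, eigen a 1 x <-> exists k : F, x = k *: a].

Definition subalgebra (B : A -> Prop) : Prop :=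
  [/\ B 0, forall x y, B x -> B y -> B (x + y),
      forall k x, B x -> B (k *: x) & forall x y, B x -> B y -> B (x ** y)].

Definition generates S : Prop :=
  forall B : A -> Prop, subalgebra B -> (forall a, S a -> B a) ->
  forall x, B x.

Definition direct_sum3 (U V W : A -> Prop) : Prop :=
  forall x, exists! p : A * A * A,
    [/\ U p.1.1, V p.1.2, W p.2 & x = p.1.1 + p.1.2 + p.2].

(* The sign group {+, -} is (bool, addb), with true for the sign -.           *)
Definition signed_part eta a (minus : bool) x : Prop :=
  if minus then eigen a eta x
  else exists u v, [/\ eigen a 1 u, eigen a 0 v & x = u + v].

Definition jordan_fusion eta a : Prop :=
  [/\ direct_sum3 (eigen a 1) (eigen a 0) (eigen a eta),
      forall x y, eigen a 0 x -> eigen a 0 y -> eigen a 0 (x ** y)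
    & forall (d e : bool) x y, signed_part eta a d x -> signed_part eta a e y ->
        signed_part eta a (d (+) e) (x ** y)].

Definition axial_of_jordan_type eta S : Prop :=
  [/\ eta != 0, eta != 1, generates S
    & forall a, S a -> primitive_axis a /\ jordan_fusion eta a].

End JordanType.

(* The octonion x.1 + \sum_t x.2_t i_t is represented by the pair x.          *)
Definition octonion (F : fieldType) : Type := (F^o * 'rV[F]_7)%type.

HB.instance Definition _ (F : fieldType) :=
  GRing.Lmodule.copy (octonion F) (F^o * 'rV[F]_7)%type.

Section Octonions.
Variable F : fieldType.
Implicit Types (x y : octonion F) (u v : 'rV[F]_7) (s t : 'I_7).

Definition oreal (k : F) : octonion F := (k, 0).
Definition oim u : octonion F := (0, u).

(* i_t; the subscript is reduced modulo 7.                                    *)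
Definition oi (t : nat) : octonion F := oim (delta_mx 0 (inZp t : 'I_7)).

(* Imaginary part of the product of the imaginary octonions u and v. For each *)
(* t, the three summands come from ij = k = -ji, jk = i = -kj, ki = j = -ik   *)
(* with i = i_t, j = i_(t+1), k = i_(t+3); additions of indices are in Z/7.   *)
Definition ocross u v : 'rV[F]_7 :=
  \sum_(t < 7)
    let i := t in let j := t + inZp 1 in let k := t + inZp 3 in
    ((u 0 i * v 0 j - u 0 j * v 0 i) *: delta_mx 0 k
   + (u 0 j * v 0 k - u 0 k * v 0 j) *: delta_mx 0 i
   + (u 0 k * v 0 i - u 0 i * v 0 k) *: delta_mx 0 j).

Definition omul x y : octonion F :=
  (x.1 * y.1 - \sum_(t < 7) x.2 0 t * y.2 0 t,
   x.1 *: y.2 + y.1 *: x.2 + ocross x.2 y.2).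

Definition oconj x : octonion F := (x.1, - x.2).

Lemma octP x y : x.1 = y.1 -> (forall t, x.2 0 t = y.2 0 t) -> x = y.
Proof.
case: x y => [a u] [b v] /= -> uv; congr (_, _).
by apply/rowP.
Qed.

Let ocrossDl u1 u2 v : ocross (u1 + u2) v = ocross u1 v + ocross u2 v.
Proof.
rewrite /ocross -big_split /=; apply: eq_bigr => t _.
by apply/rowP => s; rewrite !mxE; ring.
Qed.

Let ocrossZl k u v : ocross (k *: u) v = k *: ocross u v.
Proof.
rewrite /ocross scaler_sumr /=; apply: eq_bigr => t _.
by apply/rowP => s; rewrite !mxE; ring.
Qed.

Let ocrossC u v : ocross u v = - ocross v u.
Proof.
rewrite /ocross -sumrN; apply: eq_bigr => t _.
by apply/rowP => s; rewrite !mxE; ring.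
Qed.

Let omulDl : left_distributive omul +%R.
Proof.
move=> [a u] [b v] [c w]; congr (_, _) => /=.
  under eq_bigr do rewrite mxE mulrDl.
  by rewrite big_split /=; ring.
by rewrite ocrossDl; apply/rowP => s; rewrite !mxE; ring.
Qed.

Let omulZl k x y : omul (k *: x) y = k *: omul x y.
Proof.
case: x y => [a u] [b v]; congr (_, _) => /=.
  under eq_bigr do rewrite mxE -mulrA.
  by rewrite -mulr_sumr /GRing.scale /=; ring.
by rewrite ocrossZl; apply/rowP => s; rewrite !mxE /GRing.scale /=; ring.
Qed.

Lemma oconjK : involutive oconj.
Proof. by case=> a u; rewrite /oconj /= opprK. Qed.

Let oconjD x y : oconj (x + y) = oconj x + oconj y.
Proof. by congr (_, _); rewrite /= opprD. Qed.

Let oconjZ k x : oconj (k *: x) = k *: oconj x.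
Proof. by congr (_, _); rewrite /= scalerN. Qed.

Let ocrossNN u v : ocross (- u) (- v) = ocross u v.
Proof.
apply: eq_bigr => t _.
by apply/rowP => s; rewrite !mxE; ring.
Qed.

Let oconj_omul x y : oconj (omul x y) = omul (oconj y) (oconj x).
Proof.
case: x y => [a u] [b v]; congr (_, _) => /=.
  by rewrite mulrC; congr (_ - _); apply: eq_bigr => t _; rewrite !mxE; ring.
by rewrite ocrossNN (ocrossC u); apply/rowP => s; rewrite !mxE; ring.
Qed.

Let omul_conj x y : omul x y = oconj (omul (oconj y) (oconj x)).
Proof. by rewrite -oconj_omul oconjK. Qed.

Let omulDr : right_distributive omul +%R.
Proof.
by move=> x y z; rewrite omul_conj oconjD omulDl oconjD -!omul_conj.
Qed.

Let omulZr k x y : omul x (k *: y) = k *: omul x y.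
Proof. by rewrite omul_conj oconjZ omulZl oconjZ -omul_conj. Qed.

HB.instance Definition _ := Lmodule_isNonAssocAlgebra.Build F (octonion F)
  omulDl omulDr omulZl omulZr.

Lemma oconjM x y : oconj (x ** y) = oconj y ** oconj x.
Proof. exact: oconj_omul. Qed.

Lemma oconj_is_linear : linear oconj.
Proof. by move=> k x y; rewrite oconjD oconjZ. Qed.
HB.instance Definition _ :=
  GRing.isLinear.Build F (octonion F) (octonion F) _ oconj oconj_is_linear.

Lemma octonion_basisE x : x = x.1 *: oreal 1 + \sum_(t < 7) x.2 0 t *: oi t.
Proof.
have oimD u v : oim (u + v) = oim u + oim v by congr (_, _); rewrite /= addr0.
have ->: \sum_(t < 7) x.2 0 t *: oi t = oim x.2.
  rewrite [in RHS](row_sum_delta x.2) (big_morph oim oimD (erefl _)).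
  apply: eq_bigr => t _; rewrite /oi valZpK.
  by congr (_, _); rewrite /= /GRing.scale /= mulr0.
case: x => a u; congr (_, _) => /=; last by rewrite scaler0 add0r.
by rewrite addr0 /GRing.scale /= mulr1.
Qed.

Lemma omul1l x : oreal 1 ** x = x.
Proof.
have ocross0 v : ocross 0 v = 0 by have:= ocrossZl 0 0 v; rewrite !scale0r.
case: x => a u; congr (_, _) => /=.
  by rewrite big1 ?mul1r ?subr0 // => t _; rewrite mxE mul0r.
by rewrite ocross0 scale1r scaler0 !addr0.
Qed.

Lemma omul1r x : x ** oreal 1 = x.
Proof.
have conj1 : oconj (oreal 1) = oreal 1 by congr (_, _); rewrite /= oppr0.
by rewrite /namul /= omul_conj conj1 [omul _ _]omul1l oconjK.
Qed.

Lemma oi_sqr (t : nat) : oi t ** oi t = - oreal 1.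
Proof.
congr (_, _) => /=.
  rewrite (bigD1 (inZp t)) //= big1 => [|s /negPf st]; rewrite !mxE ?eqxx /= /= ?st /=.
  - by rewrite mulr0 mulr1 addr0 sub0r.
  - by rewrite mulr0.
rewrite !scale0r !add0r oppr0 /ocross big1 // => s _.
by apply/rowP => r; rewrite !mxE; ring.
Qed.

Let oi_mul_lines (t : 'I_7) :
  [/\ ocross (delta_mx 0 t) (delta_mx 0 (inZp t.+1)) = delta_mx 0 (inZp t.+3),
      ocross (delta_mx 0 (inZp t.+1)) (delta_mx 0 (inZp t.+3)) = delta_mx 0 t
    & ocross (delta_mx 0 (inZp t.+3)) (delta_mx 0 t) = delta_mx 0 (inZp t.+1)].
Proof.
by split; apply/rowP => s; rewrite /ocross summxE !big_ord_recl big_ord0 !mxE;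
  case: t => [[|[|[|[|[|[|[|//]]]]]]]] ?;
  case: s => [[|[|[|[|[|[|[|//]]]]]]]] ? /=; rewrite /=; ring.
Qed.

Let oi_mul (s t : nat) : inZp s != inZp t :> 'I_7 ->
  oi s ** oi t = oim (ocross (delta_mx 0 (inZp s)) (delta_mx 0 (inZp t))).
Proof.
move=> /negPf st; congr (_, _) => /=.
  rewrite mul0r sub0r big1 ?oppr0 // => r _; rewrite !mxE /=.
  by case: (r =P inZp s) => [->|_]; rewrite ?st /= ?mulr0 ?mul0r.
by rewrite !scale0r !add0r.
Qed.

Lemma oi_mulE (t : nat) :
  [/\ oi t ** oi t.+1 = oi t.+3, oi t.+1 ** oi t = - oi t.+3,
      oi t.+1 ** oi t.+3 = oi t, oi t.+3 ** oi t.+1 = - oi t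
    & oi t.+3 ** oi t = oi t.+1 /\ oi t ** oi t.+3 = - oi t.+1].
Proof.
have oiN u : oim (- u) = - oim u by congr (_, _); rewrite /= oppr0.
pose i : 'I_7 := inZp t.
have j_i : inZp t.+1 = inZp i.+1 :> 'I_7.
  by apply: val_inj; rewrite /= -addn1 -modnDml addn1.
have k_i : inZp t.+3 = inZp i.+3 :> 'I_7.
  by apply: val_inj; rewrite /= -addn3 -modnDml addn3.
have [ij jk ki] := oi_mul_lines i.
have [n1 n2 n3] : [/\ i != inZp i.+1, inZp i.+1 != inZp i.+3 :> 'I_7
                    & inZp i.+3 != i].
  by clear; case: i => [[|[|[|[|[|[|[|//]]]]]]]] ?.
split; last split; rewrite oi_mul ?j_i ?k_i -/i // 1?eq_sym // 1?ocrossC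
  ?ij ?jk ?ki ?oiN /oi ?j_i ?k_i -/i //.
all: by rewrite ?opprK // ocrossC ?ij ?jk ?ki ?oiN ?opprK.
Qed.

End Octonions.

(* The alias carries the F-space structure: 'M[octonion F]_3 itself would only*)
(* be a module over octonion F, if octonion F were a ring.                    *)
Definition octmx (F : fieldType) : Type := 'M[octonion F]_3.
HB.instance Definition _ (F : fieldType) :=
  GRing.Zmodule.copy (octmx F) 'M[octonion F]_3.

Section Albert.
Variable F : fieldType.
Implicit Types X Y : octmx F.

Definition octmx_scale (k : F) X : octmx F := map_mx (fun x => k *: x) X.

Let octmx_scaleA k l X :
  octmx_scale k (octmx_scale l X) = octmx_scale (k * l) X.
Proof. by apply/matrixP => i j; rewrite !mxE scalerA. Qed.
Let octmx_scale1 : left_id 1 octmx_scale.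
Proof. by move=> X; apply/matrixP => i j; rewrite !mxE scale1r. Qed.
Let octmx_scaleDr : right_distributive octmx_scale +%R.
Proof. by move=> k X Y; apply/matrixP => i j; rewrite !mxE scalerDr. Qed.
Let octmx_scaleDl X : {morph octmx_scale^~ X : k l / k + l}.
Proof. by move=> k l; apply/matrixP => i j; rewrite !mxE scalerDl. Qed.

HB.instance Definition _ := GRing.Zmodule_isLmodule.Build F (octmx F)
  octmx_scaleA octmx_scale1 octmx_scaleDr octmx_scaleDl.

Definition octmx_mul X Y : octmx F :=
  \matrix_(i, j) \sum_(k < 3) X i k ** Y k j.

Definition hermitian_real_diag : {pred octmx F} := fun X =>
  (X^T == map_mx (@oconj F) X) && [forall i, (X i i).2 == 0].

Let hrdP X : reflect ((forall i j, X j i = oconj (X i j)) /\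
                      (forall i, (X i i).2 = 0)) (X \in hermitian_real_diag).
Proof.
apply: (iffP andP) => [[/eqP XT /forallP X2]|[XT X2]]; split.
- by move=> i j; have /matrixP/(_ i j) := XT; rewrite !mxE.
- by move=> i; apply/eqP.
- by apply/eqP/matrixP => i j; rewrite !mxE.
- by apply/forallP => i; rewrite X2.
Qed.

Lemma hermitian_submod_closed : submod_closed hermitian_real_diag.
Proof.
split=> [|k X Y /hrdP[XT X2] /hrdP[YT Y2]]; apply/hrdP; split=> [i j|i].
- by rewrite !mxE [RHS]linear0.
- by rewrite !mxE.
- by rewrite !mxE XT YT [RHS]linearP.
- by rewrite !mxE /= X2 Y2 scaler0 addr0.
Qed.

HB.instance Definition _ := GRing.isSubmodClosed.Build F (octmx F)
  hermitian_real_diag hermitian_submod_closed.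

Record albert : Type := Albert {
  albert_mx : octmx F;
  albert_mxP : albert_mx \in hermitian_real_diag
}.

HB.instance Definition _ := [isSub for albert_mx].
HB.instance Definition _ := [Choice of albert by <:].
HB.instance Definition _ := [SubChoice_isSubLmodule of albert by <:].

Definition jordan_mul X Y : octmx F :=
  2%:R^-1 *: (octmx_mul X Y + octmx_mul Y X).

Lemma jordan_mul_closed (x y : albert) :
  jordan_mul (albert_mx x) (albert_mx y) \in hermitian_real_diag.
Proof.
case: x y => [X /hrdP[XT X2]] [Y /hrdP[YT Y2]] /=.
have mulT i j : octmx_mul Y X j i = oconj (octmx_mul X Y i j).
  rewrite !mxE linear_sum; apply: eq_bigr => k _ /=.
  by rewrite oconjM -(XT i k) -(YT k j).
apply: rpredZ; apply/hrdP; split=> [i j|i].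
  rewrite [LHS]mxE [in RHS]mxE linearD /= -mulT addrC; congr (_ + _).
  by rewrite mulT oconjK.
by rewrite mxE mulT /= addrN.
Qed.

Definition albert_mul (x y : albert) : albert :=
  Albert (jordan_mul_closed x y).

Let octmx_mulDl : left_distributive octmx_mul +%R.
Proof.
move=> X Y Z; apply/matrixP => i j; rewrite !mxE -big_split /=.
by apply: eq_bigr => k _; rewrite !mxE namulDl.
Qed.
Let octmx_mulDr : right_distributive octmx_mul +%R.
Proof.
move=> X Y Z; apply/matrixP => i j; rewrite !mxE -big_split /=.
by apply: eq_bigr => k _; rewrite !mxE namulDr.
Qed.
Let octmx_mulZl k X Y : octmx_mul (k *: X) Y = k *: octmx_mul X Y.
Proof.
apply/matrixP => i j; rewrite !mxE scaler_sumr.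
by apply: eq_bigr => l _; rewrite !mxE namulZl.
Qed.
Let octmx_mulZr k X Y : octmx_mul X (k *: Y) = k *: octmx_mul X Y.
Proof.
apply/matrixP => i j; rewrite !mxE scaler_sumr.
by apply: eq_bigr => l _; rewrite !mxE namulZr.
Qed.

Let albert_mulC : commutative albert_mul.
Proof. by move=> x y; apply: val_inj; rewrite /= /jordan_mul addrC. Qed.
Let albert_mulDl : left_distributive albert_mul +%R.
Proof.
move=> x y z; apply: val_inj; rewrite /= /jordan_mul octmx_mulDl octmx_mulDr.
by rewrite -scalerDr addrACA.
Qed.
Let albert_mulDr : right_distributive albert_mul +%R.
Proof. by move=> x y z; rewrite albert_mulC albert_mulDl !(albert_mulC x). Qed.
Let albert_mulZl k x y : albert_mul (k *: x) y = k *: albert_mul x y.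
Proof.
apply: val_inj; rewrite /= /jordan_mul octmx_mulZl octmx_mulZr.
by rewrite -scalerDr !scalerA mulrC.
Qed.
Let albert_mulZr k x y : albert_mul x (k *: y) = k *: albert_mul x y.
Proof. by rewrite albert_mulC albert_mulZl albert_mulC. Qed.

HB.instance Definition _ := Lmodule_isNonAssocAlgebra.Build F albert
  albert_mulDl albert_mulDr albert_mulZl albert_mulZr.
HB.instance Definition _ := NonAssocAlgebra_isCommutative.Build F albert
  albert_mulC.

(* (d, e, f | D, E, G) in the usual notation for elements of the algebra.     *)
Definition albert_elt_mx (d e f : F) (D E G : octonion F) : octmx F :=
  \matrix_(i < 3, j < 3) nth 0 (nth [::]
    [:: [:: oreal d; G;       oconj E];
        [:: oconj G; oreal e; D      ];
        [:: E;       oconj D; oreal f]] i) j.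

Lemma albert_elt_mxP d e f D E G :
  albert_elt_mx d e f D E G \in hermitian_real_diag.
Proof.
have conj_real k : oconj (oreal k) = oreal k by congr (_, _); rewrite /= oppr0.
apply/hrdP; split.
  by move=> [[|[|[|//]]] ?] [[|[|[|//]]] ?]; rewrite !mxE /= ?oconjK ?conj_real.
by move=> [[|[|[|//]]] ?]; rewrite !mxE.
Qed.

Definition albert_elt d e f D E G : albert :=
  Albert (albert_elt_mxP d e f D E G).

End Albert.

Arguments oi {F} t.
Arguments albert_elt {F} d e f D E G.

(* Main.v *)
(** For an idempotent [a] of a commutative algebra, two bilinear consequences of
    the Jordan identity, obtained by linearising it and putting [a] for two of
    its four arguments, give the Peirce fusion rules of [a]; together with
    [2 a(ax) - ax \in F a] they also give semisimplicity and primitivity.  For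
    the four given axes these identities only involve the integral structure
    constants of the algebra, so it is enough to check them on pairs of basis
    elements with integer arithmetic.

    For generation, the three diagonal idempotents are integral combinations of
    products of [a], [b], [c].  They separate the matrix
    entries of the four axes, so that a subalgebra containing the axes contains
    [i_2], [i_4] in slot D, [i_1], [i_3] in slot E and [i_0], [i_6] in slot F;
    products of these basis elements yield all the others. *)

Require Import Defs.
From Stdlib Require Import BinInt.
From HB Require Import structures.
From mathcomp Require Import all_boot all_order all_algebra.
From mathcomp Require Import ring zify ssrZ.

Set Implicit Arguments.
Unset Strict Implicit.

Import GRing.Theory.
Local Open Scope ring_scope.

(** * Elementary rules in non-associative algebras *)

Section NonAssociative.
Variables (F : fieldType) (A : naAlgType F).
Implicit Types x y z : A.

Lemma namulr0 x : x ** 0 = 0.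
Proof. by have := namulZr (0 : F) x 0; rewrite !scale0r. Qed.

Lemma namul0r x : 0 ** x = 0.
Proof. by have := namulZl (0 : F) 0 x; rewrite !scale0r. Qed.

Lemma namulNr x y : x ** - y = - (x ** y).
Proof. by rewrite -scaleN1r namulZr scaleN1r. Qed.

Lemma namulBr x y z : x ** (y - z) = x ** y - x ** z.
Proof. by rewrite namulDr namulNr. Qed.

End NonAssociative.

(** * Peirce decomposition and fusion rules of an idempotent *)

Section PeirceDecomposition.
Variables (F : fieldType) (A : comNaAlgType F) (a : A).
Hypothesis two_neq0 : 2%:R != 0 :> F.
Local Notation half := (2%:R^-1 : F).
Hypothesis aa : a ** a = a.
Hypothesis a_neq0 : a != 0.
Hypothesis peirce1 : forall x,
  exists k, 2%:R *: (a ** (a ** x)) - a ** x = k *: a.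
Hypothesis jordan_xy : forall x y,
  2%:R *: ((a ** x) ** (a ** y)) + a ** (x ** y) =
  2%:R *: (a ** ((a ** x) ** y)) + (a ** y) ** x.
Hypothesis jordan_aa : forall x y,
  2%:R *: ((a ** x) ** (a ** y)) + a ** (x ** y) =
  (a ** (a ** x)) ** y + (a ** (a ** y)) ** x + a ** (a ** (x ** y)).

Let half_double (x : A) : half *: (2%:R *: x) = x.
Proof. by rewrite scalerA mulVf ?scale1r. Qed.
Let double_half (x : A) : 2%:R *: (half *: x) = x.
Proof. by rewrite scalerA mulfV ?scale1r. Qed.
Let double (x : A) : 2%:R *: x = x + x.
Proof. by rewrite scaler_nat mulr2n. Qed.

(* With [y = a x] and [k a = 2 a y - y], the vector [v = y - k a] satisfies
   [2 a v = v], and [x = k a + (x - k a - 2 v) + 2 v]. *)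
Lemma peirce_decomposition x : exists k u v,
  [/\ eigen a 0 u, eigen a half v & x = k *: a + u + v].
Proof.
have [k] := peirce1 x; set y := a ** x => kE.
pose v := y - k *: a; exists k, (x - k *: a - 2%:R *: v), (2%:R *: v).
have av : a ** v = half *: v.
  rewrite -[LHS]half_double; congr (_ *: _).
  have ay : 2%:R *: (a ** y) = k *: a + y by rewrite -kE subrK.
  by rewrite namulBr namulZr aa scalerBr ay double opprD addrACA subrr add0r.
split; last by rewrite -addrA subrK addrC subrK.
  by rewrite /eigen !namulBr !namulZr aa av scale0r double_half -/y -/v subrr.
by rewrite /eigen namulZr av !scalerA mulrC.
Qed.

(** For [a ** x = x] the left side of [peirce1] collapses to [x]. *)
Lemma eigen1_scale x : eigen a 1 x <-> exists k, x = k *: a.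
Proof.
split=> [ax|[k ->]]; last by rewrite /eigen namulZr aa scale1r.
have [k] := peirce1 x; rewrite !ax !scale1r ax scale1r double addrK.
by exists k.
Qed.

(** Multiplying the relation by [a] once and twice scales [uh] by 1/2 and by 1/4 and kills [u0].
    Comparing the results gives [uh = 0], as 2 is invertible. *)
Lemma peirce_direct u1 u0 uh : eigen a 1 u1 -> eigen a 0 u0 ->
  eigen a half uh -> u1 + u0 + uh = 0 -> [/\ u1 = 0, u0 = 0 & uh = 0].
Proof.
rewrite /eigen scale1r scale0r => e1 e0 eh s0.
have sa : u1 + half *: uh = 0.
  by rewrite -e1 -eh -[a ** u1]addr0 -e0 -!namulDr s0 namulr0.
have saa : u1 + half *: (half *: uh) = 0.
  by rewrite -[in LHS]e1 -eh -namulZr -namulDr sa namulr0.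
have uh0 : uh = 0.
  have: half *: (half *: uh) = half *: uh by apply: (addrI u1); rewrite sa saa.
  move/(congr1 ( *:%R 2%:R)); rewrite !double_half => /(congr1 ( *:%R 2%:R)).
  by rewrite double_half double => /eqP; rewrite addrC -subr_eq subrr => /eqP.
move: sa s0; rewrite uh0 scaler0 !addr0 => ->; rewrite add0r => ->.
by [].
Qed.

Lemma peirce_direct_sum : direct_sum3 (eigen a 1) (eigen a 0) (eigen a half).
Proof.
move=> x; have [k [u [v [e0 eh xE]]]] := peirce_decomposition x.
exists (k *: a, u, v); split=> [|[[w1 w0] wh] /= [e1' e0' eh' xE']].
  by split=> //=; apply/eigen1_scale; exists k.
have eB l y z : eigen a l y -> eigen a l z -> eigen a l (y - z).
  by move=> ey ez; rewrite /eigen namulBr ey ez scalerBr.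
have e1 : eigen a 1 (k *: a) by apply/eigen1_scale; exists k.
have [] := peirce_direct (eB _ _ _ e1 e1') (eB _ _ _ e0 e0') (eB _ _ _ eh eh').
  by rewrite [_ + (u - _)]addrACA -opprD addrACA -opprD -xE -xE' subrr.
by move=> /subr0_eq -> /subr0_eq -> /subr0_eq ->.
Qed.

(** For [a ** x = 0], [jordan_xy] reduces to [a ** (x ** y) = (a ** y) ** x], so multiplication by
    [x] preserves the eigenspaces of [a]; [fusion_0h] is another case of this. *)
Lemma fusion_00 x y : eigen a 0 x -> eigen a 0 y -> eigen a 0 (x ** y).
Proof.
rewrite /eigen !scale0r => ax ay; have := jordan_xy x y.
by rewrite ax ay !namul0r namulr0 scaler0 add0r addr0.
Qed.

Lemma fusion_0h x y : eigen a 0 x -> eigen a half y -> eigen a half (x ** y).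
Proof.
rewrite /eigen !scale0r => ax ay; have := jordan_xy x y.
by rewrite ax ay !namul0r namulr0 scaler0 !add0r namulZl (namulC y).
Qed.

(** In [jordan_aa] the term [2 (a x) (a y)] and the first two terms on the right all become
    multiples of [x ** y] and cancel: 2/4 against 1/4 + 1/4. *)
Lemma fusion_hh x y : eigen a half x -> eigen a half y ->
  a ** (a ** (x ** y)) = a ** (x ** y).
Proof.
rewrite /eigen => ax ay; have := jordan_aa x y.
rewrite ax ay !(namulZl, namulZr) ax ay !namulZl (namulC y x) double_half.
rewrite -scalerDr -(double (_ *: _)) double_half.
by move/addrI.
Qed.

Lemma primitive_axis_of_jordan : primitive_axis a.
Proof.
split=> //; last exact: eigen1_scale.
split=> // x; have [k [u [v [e0 eh xE]]]] := peirce_decomposition x.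
exists [:: (1, k *: a); (0, u); (half, v)]; split.
  move=> p; rewrite !inE => /or3P[]/eqP-> //=.
  by apply/eigen1_scale; exists k.
by rewrite !big_cons big_nil /= addr0 addrA.
Qed.

Lemma jordan_fusion_of_jordan : jordan_fusion half a.
Proof.
have ha_mul u v y k : u = k *: a -> eigen a 0 v -> eigen a half y ->
    eigen a half ((u + v) ** y).
  move=> -> av ay; rewrite /eigen namulDl namulDr (@fusion_0h v) // scalerDr.
  by rewrite !(namulZl, namulZr, ay) !scalerA; congr (_ *: _ + _); ring.
split; [exact: peirce_direct_sum | exact: fusion_00 |].
case=> [] [] x y /=.
(* By [fusion_hh], [a] acts idempotently on [x ** y], so its image is the 1-part and the remainder
   the 0-part. *)
- move=> ax ay; exists (a ** (x ** y)), (x ** y - a ** (x ** y)).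
  split; last by rewrite addrC subrK.
    by rewrite /eigen fusion_hh // scale1r.
  by rewrite /eigen namulBr fusion_hh // subrr scale0r.
- move=> ax [u [v [/eigen1_scale[k uE] av ->]]]; rewrite namulC.
  exact: ha_mul uE av ax.
- move=> [u [v [/eigen1_scale[k uE] av ->]]] ay; exact: ha_mul uE av ay.
move=> [u [v [/eigen1_scale[k ->] av ->]]] [w [z [/eigen1_scale[l ->] az ->]]].
exists (k *: a ** (l *: a)), (v ** z); split; last 1 first.
- move: av az; rewrite /eigen !scale0r => av az.
  rewrite namulDl !namulDr (namulZl k a z) az (namulZr l v a) (namulC v a) av.
  by rewrite !scaler0 addr0 add0r.
- by apply/eigen1_scale; exists (k * l); rewrite namulZl namulZr aa scalerA.
exact: fusion_00.
Qed.

End PeirceDecomposition.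

(** * The octonion norm form and the multiplication table of the units *)

Section OctonionUnits.
Variable F : fieldType.
Implicit Types x y : octonion F.

(** Half the polarisation of the octonion norm; the eight units are orthonormal for it. *)
Definition odot x y : F := x.1 * y.1 + \sum_(t < 7) x.2 0 t * y.2 0 t.

Lemma odotC x y : odot x y = odot y x.
Proof.
by rewrite /odot mulrC; congr (_ + _); apply: eq_bigr => t _; rewrite mulrC.
Qed.

Lemma odot0 x : odot x 0 = 0.
Proof. by rewrite /odot mulr0 add0r big1 // => t _; rewrite mxE mulr0. Qed.

Lemma omul_conj_fst x y : (x ** oconj y).1 = odot x y.
Proof.
rewrite /= /odot -sumrN; congr (_ + _); apply: eq_bigr => t _.
by rewrite !mxE mulrN opprK.
Qed.

Lemma oconj_mul_fst x y : (oconj x ** y).1 = odot x y.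
Proof.
rewrite /= /odot -sumrN; congr (_ + _); apply: eq_bigr => t _.
by rewrite !mxE mulNr opprK.
Qed.

Lemma orealE k : oreal k = k *: oreal (1 : F).
Proof. by congr (_, _); rewrite /= ?scaler0 // /GRing.scale /= mulr1. Qed.

Lemma oreal_mul k x : oreal k ** x = k *: x.
Proof. by rewrite orealE namulZl omul1l. Qed.

Lemma mul_oreal k x : x ** oreal k = k *: x.
Proof. by rewrite orealE namulZr omul1r. Qed.

(* 0 stands for the unit 1 and [t.+1] for [i_t]. *)
Definition ounit (s : nat) : octonion F := if s is t.+1 then oi t else oreal 1.

(** Coefficients live in the binary integers [Z], where [vm_compute] is fast; this ring morphism
    interprets them in [F]. *)
Definition zF (c : Z) : F := (int_of_Z c)%:~R.

(* The sign and the index of the product of two units of [ounit]; for imaginary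
   units they are determined by the difference of the indices modulo 7. *)
Definition omul_table (s t : nat) : Z * nat :=
  if s is s'.+1 then if t is t'.+1 then
    let k r := ((s' + r) %% 7).+1%N in
    match ((t' + 7 - s') %% 7)%N with
    | 0 => (-1, 0%N)
    | 1 => (1, k 3%N)
    | 2 => (1, k 6%N)
    | 3 => (-1, k 1%N)
    | 4 => (1, k 5%N)
    | 5 => (-1, k 4%N)
    | _ => (-1, k 2%N)
    end
  else (1, s) else (1, t).

Lemma oi_mod (s t : nat) : s = t %[mod 7] -> oi s = oi t :> octonion F.
Proof.
by move=> st; rewrite /oi; congr (oim (delta_mx 0 _)); apply: val_inj.
Qed.

(** The unit [i_s] lies on the three quaternionic triples [t, t+1, t+3] with [t = s], [s+6], [s+4].
    They contain all six other imaginary units, so their relations give all these products. *)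
Lemma oi_mulD (s : nat) :
  [/\ oi s ** oi (s + 1) = oi (s + 3) :> octonion F,
      oi s ** oi (s + 2) = oi (s + 6) :> octonion F
    & oi s ** oi (s + 4) = oi (s + 5) :> octonion F] /\
  [/\ oi s ** oi (s + 3) = - oi (s + 1) :> octonion F,
      oi s ** oi (s + 5) = - oi (s + 4) :> octonion F
    & oi s ** oi (s + 6) = - oi (s + 2) :> octonion F].
Proof.
have i7 r : oi r.+3.+4 = oi r :> octonion F.
  by apply: oi_mod; rewrite -[r.+3.+4]/((7 + r)%N) modnDl.
rewrite !addnS !addn0; have [-> _ _ _ [_ ->]] := oi_mulE F s.
have [_ _ + _ _] := oi_mulE F (s + 6); rewrite !addnS !addn0 !i7 => ->.
have [_ + _ _ _] := oi_mulE F (s + 6); rewrite !addnS !addn0 !i7 => ->.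
have [_ _ _ _ [+ _]] := oi_mulE F (s + 4); rewrite !addnS !addn0 !i7 => ->.
have [_ _ _ + _] := oi_mulE F (s + 4); rewrite !addnS !addn0 !i7 => ->.
by [].
Qed.

Lemma zF1 : zF 1 = 1. Proof. by []. Qed.
Lemma zFN1 : zF (-1) = -1. Proof. by []. Qed.

Lemma omul_tableP s t : (s < 8)%N -> (t < 8)%N ->
  ounit s ** ounit t = zF (omul_table s t).1 *: ounit (omul_table s t).2.
Proof.
case: s => [|s] /=; first by rewrite omul1l zF1 scale1r.
case: t => [|t] /=; first by rewrite omul1r zF1 scale1r.
(* [d] is [t - s] modulo 7; the added 7 keeps the natural-number subtraction from truncating. *)
rewrite !ltnS => s7 t7; set d := ((t + 7 - s) %% 7)%N.
have -> : oi t = oi (s + d) :> octonion F.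
  by apply: oi_mod; rewrite modnDmr subnKC ?modnDr //; lia.
have oi_mod7 r : oi (r %% 7) = oi r :> octonion F.
  by apply: oi_mod; rewrite modn_mod.
have [[d1 d2 d4] [d3 d5 d6]] := oi_mulD s.
have := ltn_pmod (t + 7 - s) (isT : 0 < 7)%N.
rewrite -/d; case: d => [|[|[|[|[|[|[|//]]]]]]] _ /=.
all: rewrite ?oi_mod7 ?zF1 ?zFN1 ?scaleN1r ?scale1r // addn0; exact: oi_sqr.
Qed.

End OctonionUnits.
Arguments ounit {F}.

(** * The Jordan product in coordinates *)

Section AlbertProduct.
Variable F : fieldType.
Hypothesis two_neq0 : 2%:R != 0 :> F.
Local Notation half := (2%:R^-1 : F).
Implicit Types x y D E G : octonion F.

Let fstD x y : (x + y).1 = x.1 + y.1. Proof. by []. Qed.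
Let fstZ k x : (k *: x).1 = k * x.1. Proof. by []. Qed.

Let oconjZ k x : oconj (k *: x) = k *: oconj x. Proof. exact: linearZ. Qed.
Let oconjD x y : oconj (x + y) = oconj x + oconj y. Proof. exact: linearD. Qed.

Lemma self_conj_oreal x : oconj x = x -> x = oreal x.1.
Proof.
case: x => k u [uN]; congr (_, _); apply/rowP => t; move/rowP/(_ t): uN.
rewrite !mxE => /eqP; rewrite eq_sym -subr_eq0 opprK -mulr2n.
by rewrite -mulr_natl mulf_eq0 (negPf two_neq0) => /eqP.
Qed.

(** The left side is fixed by conjugation, hence real in characteristic other than 2, so comparing
    real parts suffices. *)
Lemma polar_norm x y :
  half *: (x ** oconj y + y ** oconj x) = oreal (odot x y).
Proof.
rewrite [LHS]self_conj_oreal.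
  congr oreal; rewrite fstZ fstD !omul_conj_fst (odotC y) -mulr2n.
  by rewrite -[odot x y *+ 2]mulr_natl mulKf.
by rewrite oconjZ oconjD !oconjM !oconjK [in LHS]addrC.
Qed.

Lemma polar_norm_conj x y :
  half *: (oconj x ** y + oconj y ** x) = oreal (odot x y).
Proof.
rewrite [LHS]self_conj_oreal.
  congr oreal; rewrite fstZ fstD !oconj_mul_fst (odotC y) -mulr2n.
  by rewrite -[odot x y *+ 2]mulr_natl mulKf.
by rewrite oconjZ oconjD !oconjM !oconjK [in LHS]addrC.
Qed.

Lemma oreal_mul2 k l :
  half *: (k *: oreal l + l *: oreal k) = oreal (k * l) :> octonion F.
Proof.
congr (_, _); rewrite /= ?scaler0 ?addr0 ?scaler0 //.
by rewrite /GRing.scale /= (mulrC l) -mulr2n -[k * l *+ 2]mulr_natl mulKf //.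
Qed.

Lemma orealD k l : oreal (k + l) = oreal k + oreal l :> octonion F.
Proof. by congr (_, _); rewrite /= addr0. Qed.

Lemma albert_elt_mul (d e f d' e' f' : F) D E G D' E' G' :
  albert_elt d e f D E G ** albert_elt d' e' f' D' E' G' =
  albert_elt (d * d' + odot E E' + odot G G')
             (e * e' + odot G G' + odot D D')
             (f * f' + odot D D' + odot E E')
    (half *: ((e + f) *: D' + (e' + f') *: D + oconj (E ** G' + E' ** G)))
    (half *: ((f + d) *: E' + (f' + d') *: E + oconj (G ** D' + G' ** D)))
    (half *: ((d + e) *: G' + (d' + e') *: G + oconj (D ** E' + D' ** E))).
Proof.
apply: val_inj; apply/matrixP => i j.
rewrite !mxE !big_ord_recl !big_ord0 !mxE.
case: i => [[|[|[|//]]] ?]; case: j => [[|[|[|//]]] ?] /=; rewrite /= !addr0.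
all: rewrite ?(oconjZ, oconjD, oconjM, oconjK) ?(oreal_mul, mul_oreal).
(* Each entry has six summands, three from either order of the factors; the [AC] patterns regroup
   them into the three pairs of the formula. *)
- by rewrite [X in _ *: X](AC ((1*2)*(1*2)) ((1*4)*(3*6)*(2*5)))
    2!scalerDr oreal_mul2 polar_norm_conj polar_norm !orealD.
- by rewrite [X in _ *: X = _](AC ((1*2)*(1*2)) ((1*5)*(4*2)*(6*3))) !scalerDl.
- by rewrite [X in _ *: X = _](AC ((1*2)*(1*2)) ((6*1)*(3*4)*(2*5))) !scalerDl.
- by rewrite [X in _ *: X = _](AC ((1*2)*(1*2)) ((4*2)*(1*5)*(3*6))) !scalerDl.
- by rewrite [X in _ *: X](AC ((1*2)*(1*2)) ((2*5)*(1*4)*(3*6)))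
    2!scalerDr oreal_mul2 polar_norm_conj polar_norm !orealD.
- by rewrite [X in _ *: X = _](AC ((1*2)*(1*2)) ((2*6)*(5*3)*(4*1))) !scalerDl.
- by rewrite [X in _ *: X = _](AC ((1*2)*(1*2)) ((3*4)*(6*1)*(5*2))) !scalerDl.
- by rewrite [X in _ *: X = _](AC ((1*2)*(1*2)) ((5*3)*(2*6)*(1*4))) !scalerDl.
- by rewrite [X in _ *: X](AC ((1*2)*(1*2)) ((3*6)*(2*5)*(1*4)))
    2!scalerDr oreal_mul2 polar_norm_conj polar_norm !orealD.
Qed.

End AlbertProduct.

(** * Integral combinations of basis elements and their computable product *)

(* A key [(p, s)] with [p < 3] stands for the octonion unit of index [s] in the
   p-th of the slots D, E, F if [s < 8], and for the p-th diagonal idempotent if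
   [s = 8].  A [comb] is an integral linear combination of keys, possibly with
   repetitions. *)
Definition key : Type := (nat * nat)%type.
Definition comb : Type := seq (Z * key).

Definition keys : seq key := [seq (p, s) | p <- iota 0 3, s <- iota 0 9].

Definition is_key (x : key) : bool := (x.1 < 3)%N && (x.2 < 9)%N.

Lemma mem_keys x : is_key x -> x \in keys.
Proof.
case: x => p s /andP[/= p3 s9].
by apply/allpairsP; exists (p, s); rewrite !mem_iota.
Qed.

(* Twice the product, which makes the structure constants integral. *)
Definition mul_table (x y : key) : comb :=
  if ~~ (is_key x && is_key y) then [::] else
  let: (p, s) := x in let: (q, t) := y in
  if s == 8 then
    if t == 8 then if p == q then [:: (2, x)] else [::]
    else if p == q then [::] else [:: (1, y)]
  else if t == 8 then if p == q then [::] else [:: (1, x)]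
  else if p == q then
    if s == t then
      [seq (2, (r, 8%N)) | r <- iota 0 3 & r != p]
    else [::]
  else
    let: (c, k) :=
      if q == (p.+1 %% 3)%N then omul_table s t else omul_table t s in
    [:: (if k == 0%N then c else - c, ((3 - p - q)%N, k))].

Definition scalec (k : Z) (u : comb) : comb := [seq (k * a.1, a.2) | a <- u].

(** Inherits the factor 2 of [mul_table]. *)
Definition mulc (u v : comb) : comb :=
  flatten [seq flatten [seq scalec (a.1 * b.1) (mul_table a.2 b.2) | b <- v]
          | a <- u].

Fixpoint add_term (a : Z * key) (u : comb) : comb :=
  if u is b :: v then
    if a.2 == b.2 then (a.1 + b.1, a.2) :: v else b :: add_term a v
  else [:: a].

Definition collect (u : comb) : comb := foldr add_term [::] u.

(** Compares coefficients over the integers, so a successful test is valid in every field. *)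
Definition eqc (u v : comb) : bool :=
  all (fun a => a.1 == 0) (collect (u ++ scalec (-1) v)).

(** * Correctness of the integral computation in the Albert algebra *)

Section Evaluation.
Variable F : fieldType.
Hypothesis two_neq0 : 2%:R != 0 :> F.
Local Notation half := (2%:R^-1 : F).
Local Notation zF := (@zF F).

Definition diag (p : nat) : albert F :=
  albert_elt (p == 0)%:R (p == 1)%:R (p == 2)%:R 0 0 0.

Definition slot (p : nat) (x : octonion F) : albert F :=
  albert_elt 0 0 0 (if p == 0 then x else 0) (if p == 1 then x else 0)
    (if p == 2 then x else 0).

(** The value zero off the keys matches the empty combination returned there by [mul_table]. *)
Definition basis (x : key) : albert F :=
  if is_key x then if x.2 == 8 then diag x.1 else slot x.1 (ounit x.2) else 0.

Definition ev (u : comb) : albert F := \sum_(a <- u) zF a.1 *: basis a.2.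

Lemma zFD a b : zF (a + b) = zF a + zF b.
Proof. by rewrite /zF !rmorphD. Qed.

Lemma zFN a : zF (- a) = - zF a.
Proof. by rewrite /zF !rmorphN. Qed.

Lemma zFM a b : zF (a * b) = zF a * zF b.
Proof. by rewrite /zF !rmorphM. Qed.

Lemma albert_elt_linear k d e f D E G d' e' f' D' E' G' :
  k *: albert_elt d e f D E G + albert_elt d' e' f' D' E' G' =
  albert_elt (k * d + d') (k * e + e') (k * f + f')
    (k *: D + D') (k *: E + E') (k *: G + G') :> albert F.
Proof.
apply: val_inj; apply/matrixP => i j; rewrite !mxE.
case: i => [[|[|[|//]]] ?]; case: j => [[|[|[|//]]] ?] /=.
all: rewrite ?linearP //.
all: by rewrite /oreal; congr (_, _); rewrite /= ?scaler0 ?addr0.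
Qed.

Lemma albert_elt0 : albert_elt 0 0 0 0 0 0 = 0 :> albert F.
Proof.
have := albert_elt_linear (-1) 0 0 0 0 0 0 0 0 0 0 0 0.
by rewrite scaleN1r addNr mulr0 scaler0 !addr0.
Qed.

Lemma scale_albert_elt k d e f D E G :
  k *: albert_elt d e f D E G =
  albert_elt (k * d) (k * e) (k * f) (k *: D) (k *: E) (k *: G) :> albert F.
Proof. by rewrite -[LHS]addr0 -albert_elt0 albert_elt_linear !addr0. Qed.

Lemma albert_eltP (x : albert F) :
  exists d e f D E G, x = albert_elt d e f D E G.
Proof.
case: x => X XP; have := XP; rewrite unfold_in => /andP[/eqP XT /forallP X2].
have conjX i j : X i j = oconj (X j i).
  by have /matrixP/(_ j i) := XT; rewrite !mxE => ->.
have diagX i : X i i = @oreal F (X i i).1.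
  by rewrite /oreal [LHS]surjective_pairing (eqP (X2 i)).
pose i0 : 'I_3 := inZp 0; pose i1 : 'I_3 := inZp 1; pose i2 : 'I_3 := inZp 2.
exists (X i0 i0).1, (X i1 i1).1, (X i2 i2).1, (X i1 i2), (X i2 i0), (X i0 i1).
apply: val_inj; apply/matrixP => i j; rewrite /= mxE -!diagX -!conjX.
by case: i => [[|[|[|//]]] ?]; case: j => [[|[|[|//]]] ?]; congr (X _ _);
  apply: val_inj.
Qed.

Lemma slot_linear p k x y :
  slot p (k *: x + y) = k *: slot p x + slot p y.
Proof.
rewrite albert_elt_linear !mulr0 !addr0 /slot.
by do 3!case: ifP => _; rewrite ?scaler0 ?addr0.
Qed.

Lemma slot0 p : slot p 0 = 0.
Proof. by rewrite /slot !if_same albert_elt0. Qed.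

Lemma slotD p x y : slot p (x + y) = slot p x + slot p y.
Proof. by have := slot_linear p 1 x y; rewrite !scale1r. Qed.

Lemma slotZ p k x : slot p (k *: x) = k *: slot p x.
Proof. by have := slot_linear p k x 0; rewrite slot0 !addr0. Qed.

(** The 27 basis elements span, by [albert_eltP] and [octonion_basisE]; this reduces linear
    identities to finitely many checks. *)
Lemma albert_ind (P : albert F -> Prop) :
  (forall k x y, P x -> P y -> P (k *: x + y)) ->
  (forall x, is_key x -> P (basis x)) -> forall x, P x.
Proof.
move=> Plin Pkeys.
have P0 : P 0.
  (* Zero is obtained as [- b + b] for a basis element [b], which has the form [k *: x + y]. *)
  by rewrite -(addNr (basis (0, 0)%N)) -scaleN1r; apply: Plin; apply: Pkeys.
have Pdiag p : (p < 3)%N -> P (diag p).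
  by case: p => [|[|[|//]]] _; [have := @Pkeys (0, 8)%N
    | have := @Pkeys (1, 8)%N | have := @Pkeys (2, 8)%N] => /(_ isT).
have Punit p s : (p < 3)%N -> (s < 8)%N -> P (slot p (ounit s)).
  move=> p3 s8; have ks : is_key (p, s) by rewrite /is_key p3 ltnW.
  by have := Pkeys _ ks; rewrite /basis ks /= ltn_eqF.
have PD x y : P x -> P y -> P (x + y).
  by move=> Px Py; rewrite -(scale1r x); apply: Plin.
have PZ k x : P x -> P (k *: x).
  by move=> Px; rewrite -[_ *: _]addr0; apply: Plin.
have Pslot p x : (p < 3)%N -> P (slot p x).
  move=> p3; rewrite (octonion_basisE x) slotD slotZ.
  apply: (PD); first exact/PZ/(Punit p 0).
  rewrite (big_morph (slot p) (slotD p) (slot0 p)).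
  apply: (big_ind P) => // => t _; rewrite slotZ; apply: (PZ).
  by apply: (Punit p t.+1); rewrite // ltnS ltn_ord.
move=> x; have [d [e [f [D [E [G ->]]]]]] := albert_eltP x.
have -> : albert_elt d e f D E G = d *: diag 0 + (e *: diag 1 + (f *: diag 2 +
  (slot 0 D + (slot 1 E + slot 2 G)))).
  rewrite -[slot 0 D]scale1r -[slot 1 E]scale1r !albert_elt_linear /=.
  by rewrite !(mulr0, mulr1, scaler0, scale1r, addr0, add0r).
do 3![apply: (Plin); first exact: Pdiag].
by do 2![apply: (PD); first exact: Pslot]; apply: Pslot.
Qed.

Lemma oconj_ounit s :
  oconj (ounit s) = (if s == 0 then 1 else -1) *: ounit s :> octonion F.
Proof.
by case: s => [|s] /=; [rewrite scale1r | rewrite scaleN1r]; congr (_, _);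
  rewrite /= ?oppr0.
Qed.

Lemma odot_ounit s t : (s < 8)%N -> (t < 8)%N ->
  odot (ounit s) (ounit t) = (s == t)%:R :> F.
Proof.
case: s t => [|s] [|t]; rewrite /odot /= ?ltnS => s7 t7.
- by rewrite mulr1 big1 ?addr0 // => r _; rewrite mxE mul0r.
- by rewrite mulr0 big1 ?addr0 // => r _; rewrite mxE mul0r.
- by rewrite mul0r big1 ?addr0 // => r _; rewrite [X in _ * X]mxE mulr0.
pose i : 'I_7 := inZp s.
rewrite mul0r add0r (bigD1 i) //= big1 => [|r /negPf ri]; rewrite !mxE -/i.
  by rewrite addr0 !eqxx mul1r -val_eqE /= !modn_small.
by rewrite ri mul0r.
Qed.

Let oconj0 : oconj 0 = 0 :> octonion F. Proof. exact: linear0. Qed.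
Let od0 x : odot 0 x = 0 :> F. Proof. by rewrite odotC odot0. Qed.
Let zeroE := (oconj0, odot0, od0, @namulr0 F (octonion F),
  @namul0r F (octonion F), addr0, add0r, mul0r, mulr0, mulr1,
  scale0r, scaler0, scale1r).

Lemma diag_mul p q : (p < 3)%N -> (q < 3)%N ->
  diag p ** diag q = if p == q then diag p else 0.
Proof.
case: p => [|[|[|//]]] _; case: q => [|[|[|//]]] _.
all: by rewrite albert_elt_mul //= !zeroE ?albert_elt0.
Qed.

Lemma diag_slot p q x : (p < 3)%N -> (q < 3)%N ->
  diag p ** slot q x = if p == q then 0 else half *: slot q x.
Proof.
case: p => [|[|[|//]]] _; case: q => [|[|[|//]]] _.
all: by rewrite albert_elt_mul //= ?scale_albert_elt !zeroE ?albert_elt0.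
Qed.

Lemma slot_sqr p x y : (p < 3)%N ->
  slot p x ** slot p y = odot x y *: \sum_(r <- iota 0 3 | r != p) diag r.
Proof.
move=> p3; rewrite big_mkcond /= !big_cons big_nil.
case: p p3 => [|[|[|//]]] _; rewrite albert_elt_mul //= !zeroE.
- by rewrite -[diag 1]scale1r albert_elt_linear scale_albert_elt /= !zeroE.
- by rewrite -[diag 0]scale1r albert_elt_linear scale_albert_elt /= !zeroE.
- by rewrite -[diag 0]scale1r albert_elt_linear scale_albert_elt /= !zeroE.
Qed.

(** Slots D, E, F multiply cyclically up to conjugation, and [3 - p - q] is the remaining slot. *)
Lemma slot_mul p q x y : (p < 3)%N -> q = (p.+1 %% 3)%N ->
  slot p x ** slot q y = half *: slot (3 - p - q)%N (oconj (x ** y)).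
Proof.
by case: p => [|[|[|//]]] _ ->;
  rewrite albert_elt_mul //= scale_albert_elt !zeroE.
Qed.

Lemma ev1 k x : ev [:: (k, x)] = zF k *: basis x.
Proof. by rewrite /ev big_seq1. Qed.

Lemma basis_diag p : (p < 3)%N -> basis (p, 8%N) = diag p.
Proof. by case: p => [|[|[|//]]]. Qed.

Lemma basis_slot p s : (p < 3)%N -> (s < 8)%N ->
  basis (p, s) = slot p (ounit s).
Proof.
by move=> p3 s8; rewrite /basis /is_key p3 ltnW //= ltn_eqF.
Qed.

Lemma omul_table_lt s t : (s < 8)%N -> (t < 8)%N ->
  ((omul_table s t).2 < 8)%N.
Proof.
case: s => [|s] //; case: t => [|t] // _ _; rewrite /omul_table.
by case: ((t + 7 - s) %% 7)%N => [|[|[|[|[|[|?]]]]]] //=; rewrite ltnS ltn_mod.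
Qed.

(** The sign change for [k] other than 0 is the conjugation of an imaginary unit in [slot_mul]. *)
Lemma slot_mul_table p q s t :
  (p < 3)%N -> q = (p.+1 %% 3)%N -> (s < 8)%N -> (t < 8)%N ->
  2%:R *: (slot p (ounit s) ** slot q (ounit t)) =
  let: (c, k) := omul_table s t in
  ev [:: (if k == 0 then c else - c, ((3 - p - q)%N, k))].
Proof.
move=> p3 qE s8 t8; rewrite slot_mul // scalerA mulfV // scale1r omul_tableP //.
move: (omul_table_lt s8 t8); case: (omul_table s t) => c k /= k8.
rewrite ev1 basis_slot //; last by rewrite qE; case: p p3 {qE} => [|[|[|]]].
rewrite [oconj _]linearZ /= oconj_ounit scalerA slotZ.
by case: eqP => _; rewrite ?mulr1 // mulrN1 zFN.
Qed.

Lemma mul_tableP x y : 2%:R *: (basis x ** basis y) = ev (mul_table x y).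
Proof.
rewrite /mul_table; case: (boolP (is_key x)) => [|/negPf xN]; last first.
  by rewrite /basis xN namul0r scaler0 /ev big_nil.
case: (boolP (is_key y)) => [|/negPf yN _]; last first.
  by rewrite /basis yN namulr0 scaler0 /ev big_nil.
case: x y => [p s] [q t] /andP[/= q3 t9] /andP[/= p3 s9].
have unitP r : (r < 9)%N -> r != 8 -> (r < 8)%N.
  by rewrite ltnS leq_eqVlt => /predU1P[->|].
case: eqP => [->|/eqP/(unitP s s9) s8].
  rewrite basis_diag //; case: eqP => [->|/eqP/(unitP t t9) t8].
    rewrite basis_diag // diag_mul //.
    case: eqP => _; last by rewrite scaler0 /ev big_nil.
    by rewrite ev1 basis_diag.
  rewrite basis_slot // diag_slot //.
  case: eqP => _; first by rewrite scaler0 /ev big_nil.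
  by rewrite ev1 basis_slot // scalerA mulfV.
rewrite (@basis_slot p) //; case: eqP => [->|/eqP/(unitP t t9) t8].
  rewrite basis_diag // namulC diag_slot // eq_sym.
  case: eqP => _; first by rewrite scaler0 /ev big_nil.
  by rewrite ev1 basis_slot // scalerA mulfV.
rewrite basis_slot //; case: (p =P q) => [->|/eqP pq].
  rewrite slot_sqr // odot_ounit //.
  case: eqP => _; last by rewrite scale0r scaler0 /ev big_nil.
  rewrite scale1r /ev big_map scaler_sumr.
  by case: q q3 => [|[|[|//]]] _; rewrite !big_cons !big_nil /= !basis_diag.
case: eqP => [qE|qNE].
  by rewrite slot_mul_table //; case: (omul_table s t).
(* Distinct slots not cyclically consecutive in this order are so in the opposite one, and the
   product is commutative. *)
have pE : p = (q.+1 %% 3)%N.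
  by case: p p3 qNE pq => [|[|[|]]] //= _ ; case: q q3 => [|[|[|]]].
rewrite namulC slot_mul_table //; case: (omul_table t s) => c k.
by rewrite subnAC.
Qed.

Lemma ev_nil : ev [::] = 0. Proof. exact: big_nil. Qed.

Lemma ev_cons a u : ev (a :: u) = zF a.1 *: basis a.2 + ev u.
Proof. exact: big_cons. Qed.

Lemma ev_cat u v : ev (u ++ v) = ev u + ev v.
Proof. exact: big_cat. Qed.

Lemma ev_scale k u : ev (scalec k u) = zF k *: ev u.
Proof.
rewrite /ev big_map scaler_sumr; apply: eq_bigr => a _.
by rewrite zFM scalerA.
Qed.

Lemma ev_mul u v : ev (mulc u v) = 2%:R *: (ev u ** ev v).
Proof.
have sumr x (w : comb) : x ** ev w = \sum_(b <- w) zF b.1 *: (x ** basis b.2).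
  elim: w => [|b w IH]; first by rewrite ev_nil big_nil namulr0.
  by rewrite ev_cons big_cons namulDr IH namulZr.
have suml x (w : comb) : ev w ** x = \sum_(b <- w) zF b.1 *: (basis b.2 ** x).
  by rewrite namulC sumr; apply: eq_bigr => b _; rewrite namulC.
have ev_flatten (us : seq comb) : ev (flatten us) = \sum_(w <- us) ev w.
  exact: big_flatten.
rewrite suml scaler_sumr /mulc ev_flatten big_map; apply: eq_bigr => a _.
rewrite ev_flatten big_map sumr !scaler_sumr; apply: eq_bigr => b _.
by rewrite ev_scale -mul_tableP zFM !scalerA; congr (_ *: _); ring.
Qed.

Lemma ev_add_term a u : ev (add_term a u) = zF a.1 *: basis a.2 + ev u.
Proof.
elim: u => [|b u IH] /=; first by rewrite ev_cons.
case: eqP => [ab|_]; rewrite !ev_cons /= ?IH; last by rewrite addrCA.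
by rewrite zFD scalerDl ab addrA.
Qed.

Lemma ev_collect u : ev (collect u) = ev u.
Proof. by elim: u => [|a u IH] //=; rewrite ev_add_term IH ev_cons. Qed.

Lemma ev_eqc u v : eqc u v -> ev u = ev v.
Proof.
move/allP=> uv0; apply/eqP; rewrite -subr_eq0 -scaleN1r -zFN1 -ev_scale -ev_cat.
rewrite -ev_collect /ev big_seq big1 // => a /uv0/eqP->.
by rewrite scale0r.
Qed.

End Evaluation.

(** * The finite checks for the four axes *)

(* With [A = s a] and [l u = 2 A u = 2 s (a u)], these are the hypotheses
   [jordan_xy] and [jordan_aa] on [a] multiplied by [8 s ^ 2]. *)
Definition jordan_check (A : comb) (s : Z) : bool :=
  let l u := collect (mulc A u) in
  all (fun x => let ex := [:: (1, x)] in let lx := l ex in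
    all (fun y => let ey := [:: (1, y)] in let ly := l ey in
      let lxy := l (mulc ex ey) in
      let lhs := scalec 2 (mulc lx ly) ++ scalec (2 * s) lxy in
      eqc lhs (scalec 2 (l (mulc lx ey)) ++ scalec (2 * s) (mulc ly ex)) &&
      eqc lhs (mulc (l lx) ey ++ mulc (l ly) ex ++ l lxy)) keys) keys.

Definition coeff (A : comb) (x : key) : Z :=
  foldr (fun a c => if a.2 == x then a.1 + c else c) 0 A.

(* The multiple [k] of [a] in [peirce1] is the trace of [a x]; an off-diagonal
   unit has trace form 2 with itself, a diagonal idempotent 1. *)
Definition peirce1_check (A : comb) (s : Z) : bool :=
  let l u := collect (mulc A u) in
  all (fun x => let lx := l [:: (1, x)] in
    let c := (if x.2 == 8 then 4 else 8) * coeff A x in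
    eqc (scalec 2 (l lx) ++ scalec (- (2 * s)) lx) (scalec c A)) keys.

(** For [A = s a], idempotency of [a] reads [2 A A = 2 s A]. *)
Definition axis_check (A : comb) (s : Z) : bool :=
  [&& eqc (mulc A A) (scalec (2 * s) A), peirce1_check A s & jordan_check A s].

(* The axes without their denominators 2, 2, 2 and 9. *)
Definition axis_a : comb := [:: (1, (0, 8)%N); (1, (1, 8)%N); (1, (2, 1)%N)].
Definition axis_b : comb := [:: (1, (0, 8)%N); (1, (2, 8)%N); (1, (1, 2)%N)].
Definition axis_c : comb := [:: (1, (1, 8)%N); (1, (2, 8)%N); (1, (0, 3)%N)].
Definition axis_d : comb := [:: (1, (0, 8)%N); (4, (1, 8)%N); (4, (2, 8)%N);
  (4, (0, 5)%N); (2, (1, 4)%N); (2, (2, 7)%N)].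

Lemma axis_check_a : axis_check axis_a 2. Proof. by vm_compute. Qed.
Lemma axis_check_b : axis_check axis_b 2. Proof. by vm_compute. Qed.
Lemma axis_check_c : axis_check axis_c 2. Proof. by vm_compute. Qed.
Lemma axis_check_d : axis_check axis_d 9. Proof. by vm_compute. Qed.

(** * Reduction of linear identities to the basis *)

Section LinearMaps.
Variables (F : fieldType) (V : lmodType F) (A : naAlgType F).
Implicit Types f g : V -> A.

Lemma linear_add f g : linear f -> linear g -> linear (fun x => f x + g x).
Proof. by move=> lf lg k x y; rewrite lf lg scalerDr addrACA. Qed.

Lemma linear_scale c f : linear f -> linear (fun x => c *: f x).
Proof. by move=> lf k x y; rewrite lf scalerDr !scalerA mulrC. Qed.

Lemma linear_namull z f : linear f -> linear (fun x => f x ** z).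
Proof. by move=> lf k x y; rewrite lf namulDl namulZl. Qed.

Lemma linear_namulr z f : linear f -> linear (fun x => z ** f x).
Proof. by move=> lf k x y; rewrite lf namulDr namulZr. Qed.

End LinearMaps.

Ltac linear_tac :=
  match goal with
  | |- GRing.linear_for _ (fun x => x) => by []
  | |- GRing.linear_for _ (fun x => @?f x + @?g x) =>
      apply: (@linear_add _ _ _ f g); linear_tac
  | |- GRing.linear_for _ (fun x => ?c *: @?f x) =>
      apply: (@linear_scale _ _ _ c f); linear_tac
  | |- GRing.linear_for _ (fun x => ?z ** @?f x) =>
      apply: (@linear_namulr _ _ _ z f); linear_tac
  | |- GRing.linear_for _ (fun x => @?f x ** ?z) =>
      apply: (@linear_namull _ _ _ z f); linear_tac
  end.

Lemma linear_ext (F : fieldType) (f g : albert F -> albert F) :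
  linear f -> linear g ->
  (forall x, is_key x -> f (basis F x) = g (basis F x)) -> forall x, f x = g x.
Proof.
by move=> lf lg fg; apply: albert_ind => // k x y fx fy; rewrite lf lg fx fy.
Qed.

Ltac key_ext :=
  lazymatch goal with |- forall x, @?f x = @?g x =>
    apply: (@linear_ext _ f g); [linear_tac | linear_tac |]
  end.

(** * From the integer checks to the hypotheses on the axis *)

Section AxisChecks.
Variable F : fieldType.
Hypothesis two_neq0 : 2%:R != 0 :> F.
Local Notation half := (2%:R^-1 : F).
Local Notation zF := (@zF F).
Variables (A : comb) (s : Z).
Hypothesis s_neq0 : zF s != 0.

Variable a : albert F.
Hypothesis a_def : a = (zF s)^-1 *: ev F A.
Variable t : F.
Hypothesis tE : zF (2 * s) = t.
Let l u := collect (mulc A u).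

Let t_neq0 : t != 0. Proof. by rewrite -tE zFM mulf_neq0. Qed.

Let zF2 : zF 2 = 2%:R. Proof. by []. Qed.

(** [l] carries the factor 2 of [mulc] and the factor [s] of [A], together [t]. *)
Let aE u : a ** ev F u = t^-1 *: ev F (l u).
Proof.
rewrite a_def ev_collect ev_mul // namulZl scalerA; congr (_ *: _).
by rewrite -tE zFM; field; rewrite s_neq0.
Qed.

Let mE u v : ev F u ** ev F v = half *: ev F (mulc u v).
Proof. by rewrite ev_mul // scalerA mulVf // scale1r. Qed.

Let basisE x : basis F x = ev F [:: (1, x)].
Proof. by rewrite ev1 scale1r. Qed.

Lemma axis_idempotent : eqc (mulc A A) (scalec (2 * s) A) -> a ** a = a.
Proof.
move/(ev_eqc F); rewrite ev_scale tE => AA.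
rewrite {2}a_def namulZr aE ev_collect AA !scalerA a_def.
by congr (_ *: _); field; rewrite s_neq0.
Qed.

Lemma axis_peirce1 : peirce1_check A s ->
  forall x, exists k, 2%:R *: (a ** (a ** x)) - a ** x = k *: a.
Proof.
move=> /allP chk; apply: albert_ind => [k x y [m mE'] [n nE]|x].
  exists (k * m + n); rewrite !(namulDr, namulZr) scalerDr opprD addrACA nE.
  by rewrite scalerA mulrC -scalerA -scalerBr mE' scalerDl scalerA.
move=> /mem_keys/chk; rewrite -/(l _) /=; set c := _ * _.
move/(ev_eqc F); rewrite ev_cat !ev_scale zFN tE => e.
(* The check equates [t ^ 2] times the left side with [c A], and [A = s a]. *)
exists (t^-1 * t^-1 * zF c * zF s); rewrite basisE !(aE, namulZr) a_def scalerA.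
transitivity (t^-1 * t^-1 *: (zF c *: ev F A)).
  rewrite -e scalerDr !scalerA -scaleNr; congr (_ *: _ + _ *: _).
    by rewrite zF2; ring.
  by rewrite mulrN mulfVK.
by rewrite !scalerA mulfK.
Qed.

(** Both identities are linear in [x] and in [y], so [key_ext], applied to each variable in turn,
    reduces them to pairs of basis elements. *)
Lemma axis_jordan : jordan_check A s -> forall x y,
  2%:R *: ((a ** x) ** (a ** y)) + a ** (x ** y) =
    2%:R *: (a ** ((a ** x) ** y)) + (a ** y) ** x /\
  2%:R *: ((a ** x) ** (a ** y)) + a ** (x ** y) =
    (a ** (a ** x)) ** y + (a ** (a ** y)) ** x + a ** (a ** (x ** y)).
Proof.
move=> /allP chk x y.
suff {x y} keyJ u v (x := basis F u) (y := basis F v) : is_key u -> is_key v ->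
    2%:R *: ((a ** x) ** (a ** y)) + a ** (x ** y) =
      2%:R *: (a ** ((a ** x) ** y)) + (a ** y) ** x /\
    2%:R *: ((a ** x) ** (a ** y)) + a ** (x ** y) =
      (a ** (a ** x)) ** y + (a ** (a ** y)) ** x + a ** (a ** (x ** y)).
  by split; move: x; key_ext => x kx; move: y; key_ext => y ky;
    have [] := keyJ x y kx ky.
move=> /mem_keys ku /mem_keys kv.
have /andP[] := allP (chk _ ku) _ kv; rewrite -!/(l _).
set lhs := (_ ++ _); move=> /(ev_eqc F) + /(ev_eqc F).
rewrite !ev_cat !ev_scale tE => e1 e2.
(* The inverse of [2 t ^ 2 = 8 s ^ 2], the factor by which the checked identities were cleared of
   denominators. *)
pose k := half * t^-1 * t^-1.
have -> : 2%:R *: ((a ** x) ** (a ** y)) + a ** (x ** y) = k *: ev F lhs.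
  rewrite /x /y !basisE !(aE, mE, namulZl, namulZr) ev_cat !ev_scale.
  rewrite scalerDr !scalerA tE.
  by congr (_ *: _ + _ *: _); rewrite /k ?zF2; field; rewrite ?two_neq0 t_neq0.
rewrite ev_cat !ev_scale tE; split; [rewrite e1 | rewrite e2].
  rewrite /x /y !basisE !(aE, mE, namulZl, namulZr) scalerDr !scalerA.
  by congr (_ *: _ + _ *: _); rewrite /k ?zF2; field; rewrite ?two_neq0 t_neq0.
rewrite /x /y !basisE !(aE, mE, namulZl, namulZr) !scalerDr !scalerA addrA.
by rewrite /k (_ : t^-1 / t / 2%:R = half / t / t) //; ring.
Qed.

End AxisChecks.

Lemma jordan_axis_of_check (F : fieldType) (A : comb) (s : Z) :
  2%:R != 0 :> F -> zF F s != 0 ->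
  let a : albert F := (zF F s)^-1 *: ev F A in
  a != 0 -> axis_check A s ->
  primitive_axis a /\ jordan_fusion 2%:R^-1 a.
Proof.
move=> two_neq0 s_neq0 a a0 /and3P[AA p1 Jc].
have aa : a ** a = a by apply: axis_idempotent AA.
have {}p1 x : exists k, 2%:R *: (a ** (a ** x)) - a ** x = k *: a.
  by apply: axis_peirce1 p1 x.
have J x y := axis_jordan two_neq0 s_neq0 (erefl a) (erefl _) Jc x y.
have J1 x y := (J x y).1; have J2 x y := (J x y).2.
split; first exact: primitive_axis_of_jordan.
exact: jordan_fusion_of_jordan.
Qed.

(** * Generation by the four axes *)

Section Generation.
Variables (F : fieldType) (B : albert F -> Prop).
Hypothesis two_neq0 : 2%:R != 0 :> F.
Hypothesis subB : subalgebra B.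
Local Notation zF := (@zF F).
Local Notation ev := (@ev F).
Implicit Types (u v : comb) (S : seq key).

Let BD x y : B x -> B y -> B (x + y).
Proof. by case: subB => _ + _ _; apply. Qed.
Let BZ k x : B x -> B (k *: x).
Proof. by case: subB => _ _ + _; apply. Qed.
Let BM x y : B x -> B y -> B (x ** y).
Proof. by case: subB => _ _ _; apply. Qed.

Lemma gen_mul u v : B (ev u) -> B (ev v) -> B (ev (mulc u v)).
Proof. by move=> Bu Bv; rewrite ev_mul //; apply/BZ/BM. Qed.

Lemma gen_cat u v : B (ev u) -> B (ev v) -> B (ev (u ++ v)).
Proof. by move=> Bu Bv; rewrite ev_cat; apply: BD. Qed.

Lemma gen_scale k u : B (ev u) -> B (ev (scalec k u)).
Proof. by move=> Bu; rewrite ev_scale; apply: BZ. Qed.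

Lemma gen_basis1 k x : zF k != 0 -> B (ev [:: (k, x)]) -> B (basis F x).
Proof.
move=> k0 /(BZ (zF k)^-1).
by rewrite ev1 scalerA mulVf // scale1r.
Qed.

Lemma gen_basis k x u :
  zF k != 0 -> eqc u [:: (k, x)] -> B (ev u) -> B (basis F x).
Proof. by move=> k0 /(ev_eqc F) ->; apply: gen_basis1. Qed.

(** Keeps a product only if it is a single term whose coefficient is invertible outside
    characteristic 2; its key then lies in the subalgebra. *)
Definition unit_keys u : seq key :=
  if u is [:: (c, x)] then if c \in [:: 1; -1; 2] then [:: x] else [::]
  else [::].

Definition key_step S : seq key :=
  undup (S ++ flatten [seq flatten [seq unit_keys (mul_table x y) | y <- S]
                      | x <- S]).

Lemma gen_key_step S : (forall x, x \in S -> B (basis F x)) ->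
  forall x, x \in key_step S -> B (basis F x).
Proof.
move=> BS z; rewrite mem_undup mem_cat => /orP[/BS //|].
move=> /flatten_mapP[x /BS Bx] /flatten_mapP[y /BS By].
have := BZ 2%:R (BM Bx By); rewrite mul_tableP //.
case: (mul_table x y) => [|[c w] [|//]] //= Bw.
case: ifP => // cE; rewrite inE => /eqP->; apply: gen_basis1 Bw.
by move: cE; rewrite !inE => /or3P[]/eqP->; rewrite ?zFN1 ?oppr_eq0 ?oner_eq0.
Qed.

(* On the numerators of [a], [b], [c], in an order depending on the idempotent,
   this is 4 times a diagonal idempotent; the coefficients solve a linear system
   in the 9-dimensional subalgebra generated by [a], [b], [c]. *)
Definition corner u v w : comb :=
  scalec 2 (u ++ v ++ w) ++ scalec (-2) (mulc u w) ++ scalec (-2) (mulc v w) ++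
  mulc u (mulc v w) ++ mulc v (mulc u w) ++ scalec (-1) (mulc w (mulc u v)).

Lemma gen_corner u v w :
  B (ev u) -> B (ev v) -> B (ev w) -> B (ev (corner u v w)).
Proof.
move=> Bu Bv Bw; rewrite /corner.
by do ![done | apply: gen_cat | apply: gen_scale | apply: gen_mul].
Qed.

(** The diagonal idempotents and the six off-diagonal units occurring in the axes. *)
Definition seed_keys : seq key :=
  [:: (0, 8); (1, 8); (2, 8); (2, 1); (1, 2); (0, 3); (0, 5); (1, 4); (2, 7)]%N.

Lemma gen_axes :
  B (ev axis_a) -> B (ev axis_b) -> B (ev axis_c) -> B (ev axis_d) ->
  forall x, B x.
Proof.
move=> Ba Bb Bc Bd.
have four_neq0 : zF 4 != 0 by rewrite -[zF 4]/(4%:R) (natrM F 2 2) mulf_neq0.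
have one_neq0 : zF 1 != 0 by rewrite oner_neq0.
have E0 : B (basis F (0, 8)%N).
  by apply: gen_basis four_neq0 _ (gen_corner Ba Bb Bc); vm_compute.
have E1 : B (basis F (1, 8)%N).
  by apply: gen_basis four_neq0 _ (gen_corner Ba Bc Bb); vm_compute.
have E2 : B (basis F (2, 8)%N).
  by apply: gen_basis four_neq0 _ (gen_corner Bb Bc Ba); vm_compute.
have single x : B (basis F x) -> B (ev [:: (1, x)]) by rewrite ev1 scale1r.
(* Subtracting its two diagonal idempotents from the numerator of [a], [b] or [c] leaves its
   octonion unit. *)
have off u x y z : B (ev u) -> B (basis F x) -> B (basis F y) ->
    eqc (u ++ scalec (-1) [:: (1, x); (1, y)]) [:: (1, z)] -> B (basis F z).
  move=> Bu /single Bx /single By uE; apply: gen_basis one_neq0 uE _.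
  by apply: gen_cat => //; apply/gen_scale/(gen_cat Bx By).
(* Multiplying by two distinct diagonal idempotents leaves only the slot of the third index. The
   doubled products fix the surviving unit, so [k] is its coefficient in [axis_d]. *)
have peel k u x y z : zF k != 0 -> B (ev u) -> B (basis F x) -> B (basis F y) ->
    eqc (mulc [:: (1, x)] (mulc [:: (1, y)] u)) [:: (k, z)] -> B (basis F z).
  move=> k0 Bu /single Bx /single By uE; apply: gen_basis k0 uE _.
  exact/(gen_mul Bx)/(gen_mul By).
have S0 x : x \in seed_keys -> B (basis F x).
  rewrite !inE => /or4P[||| /or4P[|||/or3P[]]] /eqP-> //.
  - exact: off Ba E0 E1 _.
  - exact: off Bb E0 E2 _.
  - exact: off Bc E1 E2 _.
  - exact: peel four_neq0 Bd E1 E2 _.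
  - exact: (@peel 2) two_neq0 Bd E0 E2 _.
  - exact: (@peel 2) two_neq0 Bd E0 E1 _.
have iterB n : forall x, x \in iter n key_step seed_keys -> B (basis F x).
  by elim: n => [|n IH]; [exact: S0 | exact: gen_key_step IH].
(* Three rounds of products lead from the nine seeds to all 27 keys. *)
have all_keys : all (fun x => x \in iter 3 key_step seed_keys) keys.
  by vm_compute.
apply: albert_ind => [k x y Bx By|x kx].
  exact: BD (BZ k Bx) By.
exact/(iterB 3)/(allP all_keys)/mem_keys.
Qed.

End Generation.

(** * The given elements in the integral basis, and the conclusion *)

Lemma albert_elt_eq0 (F : fieldType) (d e f : F) D E G :
  albert_elt d e f D E G = 0 -> d = 0 /\ e = 0.
Proof.
move/(congr1 (@albert_mx F)) => E0; split.
  by have /matrixP/(_ (inZp 0) (inZp 0)) := E0; rewrite !mxE => -[].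
by have /matrixP/(_ (inZp 1) (inZp 1)) := E0; rewrite !mxE => -[].
Qed.

(** Index 0 being the unit 1, [i_t] has index [t + 1] in the combinations. *)
Lemma ev_axes (F : fieldType) :
  [/\ ev F axis_a = albert_elt 1 1 0 0 0 (oi 0),
      ev F axis_b = albert_elt 1 0 1 0 (oi 1) 0,
      ev F axis_c = albert_elt 0 1 1 (oi 2) 0 0
    & ev F axis_d =
      albert_elt 1 4%:R 4%:R (4%:R *: oi 4) (2%:R *: oi 3) (2%:R *: oi 6)].
Proof.
have z1 : zF F 1 = 1 by [].
have z2 : zF F 2 = 2%:R by [].
have z4 : zF F 4 = 4%:R by [].
split; rewrite /axis_a /axis_b /axis_c /axis_d !ev_cons ev_nil -albert_elt0 /=
  ?z1 ?z2 ?z4 !albert_elt_linear /=.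
all: by rewrite !(mulr0, mulr1, scaler0, scale1r, addr0, add0r).
Qed.

Theorem proposition6p1 (F : fieldType)
    (char_neq2 : 2%N \notin [pchar F]) (char_neq3 : 3%N \notin [pchar F]) :
  let a : albert F := 2%:R^-1 *: albert_elt 1 1 0 0 0 (oi 0) in
  let b : albert F := 2%:R^-1 *: albert_elt 1 0 1 0 (oi 1) 0 in
  let c : albert F := 2%:R^-1 *: albert_elt 0 1 1 (oi 2) 0 0 in
  let d : albert F := 9%:R^-1 *:
    albert_elt 1 4%:R 4%:R (4%:R *: oi 4) (2%:R *: oi 3) (2%:R *: oi 6) in
  axial_of_jordan_type (2%:R^-1 : F)
    (fun x : albert F => x \in [:: a; b; c; d]).
Proof.
move=> a b c d.
have two_neq0 : 2%:R != 0 :> F by move: char_neq2; rewrite inE.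
have three_neq0 : 3%:R != 0 :> F by move: char_neq3; rewrite inE.
(* Characteristic 3 is excluded so that the denominator of [d] is invertible. *)
have nine_neq0 : 9%:R != 0 :> F by rewrite (natrM F 3 3) mulf_neq0.
have [aE bE cE dE] := ev_axes F.
have scaled_neq0 (k : F) x : k != 0 -> x != 0 -> k^-1 *: x != 0 :> albert F.
  by move=> k0 x0; rewrite scaler_eq0 invr_eq0 negb_or k0.
split; first by rewrite invr_eq0.
- by rewrite invr_eq1 -subr_eq0 (_ : 2%:R - 1 = 1) ?oner_eq0 //; ring.
- move=> B subB Bgen.
  have BS (k : F) x : k != 0 -> B (k^-1 *: x) -> B x.
    by case: subB => _ _ BZ _ k0 /(BZ k); rewrite scalerA mulfV // scale1r.
  apply: (gen_axes two_neq0 subB); rewrite ?aE ?bE ?cE ?dE.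
  + by apply: (BS _ _ two_neq0); apply: Bgen; rewrite inE eqxx.
  + by apply: (BS _ _ two_neq0); apply: Bgen; rewrite !inE eqxx orbT.
  + by apply: (BS _ _ two_neq0); apply: Bgen; rewrite !inE eqxx !orbT.
  + by apply: (BS _ _ nine_neq0); apply: Bgen; rewrite !inE eqxx !orbT.
(* Each of the four axes has numerator 1 in one of the first two diagonal entries, so these show it
   to be nonzero. *)
have nz (e f g : F) D E G : (e != 0) || (f != 0) -> albert_elt e f g D E G != 0.
  by apply: contraTneq => /albert_elt_eq0[-> ->]; rewrite eqxx.
move=> x; rewrite !inE => /or4P[]/eqP->;
  rewrite /a /b /c /d -?aE -?bE -?cE -?dE.
- apply: (@jordan_axis_of_check F axis_a 2 two_neq0 two_neq0 _ axis_check_a).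
  by rewrite aE scaled_neq0 ?nz ?oner_neq0.
- apply: (@jordan_axis_of_check F axis_b 2 two_neq0 two_neq0 _ axis_check_b).
  by rewrite bE scaled_neq0 ?nz ?oner_neq0.
- apply: (@jordan_axis_of_check F axis_c 2 two_neq0 two_neq0 _ axis_check_c).
  by rewrite cE scaled_neq0 ?nz ?oner_neq0 ?orbT.
- apply: (@jordan_axis_of_check F axis_d 9 two_neq0 nine_neq0 _ axis_check_d).
  by rewrite dE scaled_neq0 ?nz ?oner_neq0.
Qed.
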